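(* Let $A$ and $B$ be $2n\times 2n$ real symmetric positive definite matrices. Then there exist a $2n\times2n$ real symplectic matrix $M$ and $n\times n$ diagonal matrices $D_A,D_B$ with positive diagonal entries such that $M^TAM=D_A\otimes I_2$ and $M^TBM=D_B\otimes I_2$ if and only if $AJB=BJA$.
   Context: $J:=I_n\otimes\begin{pmatrix}0&1\\-1&0\end{pmatrix}$, where $I_n$ is the $n\times n$ identity matrix and $\otimes$ is the Kronecker product. A $2n\times2n$ real matrix $M$ is symplectic if $M^TJM=J$. *)

(* Defs.v *)
From HB Require Import structures.
From mathcomp Require Import all_boot all_order all_algebra.
From mathcomp Require Import reals.
From mathcomp Require Export mxtens.
Set Implicit Arguments. Unset Strict Implicit. Unset Printing Implicit Defensive.
Import Order.TTheory GRing.Theory Num.Theory.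
Local Open Scope ring_scope.

Definition J2 (R : pzRingType) : 'M[R]_2 :=
  \matrix_(i < 2, j < 2)
    (if (i == 0 :> nat) && (j == 1 :> nat) then 1
     else if (i == 1 :> nat) && (j == 0 :> nat) then -1 else 0).

(* J := I_n (x) J2, a (n*2) x (n*2) matrix (Kronecker product, index i*2+a). *)
Definition Jmx (R : pzRingType) (n : nat) : 'M[R]_(n * 2) :=
  tensmx (1%:M : 'M[R]_n) (J2 R).

Definition symplectic (R : pzRingType) (n : nat) (M : 'M[R]_(n * 2)) : Prop :=
  M^T *m Jmx R n *m M = Jmx R n.

Definition sym_posdef (R : numDomainType) (m : nat) (A : 'M[R]_m) : Prop :=
  A^T = A /\ forall x : 'cV[R]_m, x != 0 -> 0 < (x^T *m A *m x) 0 0.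

(* Main.v *)
Require Import Defs.
From HB Require Import structures.
From mathcomp Require Import all_boot all_order all_algebra.
From mathcomp Require Import reals.
From mathcomp Require Import mxtens.
From mathcomp Require Import complex ring lra zify.
Import Order.TTheory GRing.Theory Num.Theory.
Local Open Scope ring_scope.

(** Acting on row vectors, [A J] and [B J] commute exactly when [A J B = B J A].
    A common complex eigenvector [p + i q] of the two then exists inside any
    common invariant subspace, and since [A], [B] are symmetric positive
    definite the eigenvalues are purely imaginary and [omega(p, q) <> 0], where
    [omega(x, y) = x J y^T].  After rescaling (and swapping [p] and [q] if
    needed) this is a symplectic pair rotated by both [A J] and [B J].  Its
    symplectic complement is again invariant, so one can iterate until a
    symplectic basis is reached; its vectors, transposed, are the columns of [M]. *)

(** * Common real eigenpairs of commuting matrices *)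

Lemma commuting_real_eigenpair {R : rcfType} {r : nat} {F G : 'M[R]_r} :
  (0 < r)%N -> F *m G = G *m F ->
  exists (p q : 'rV[R]_r) (a a' b b' : R),
    [/\ (p != 0) || (q != 0),
        p *m F = a *: p - a' *: q, q *m F = a' *: p + a *: q,
        p *m G = b *: p - b' *: q & q *m G = b' *: p + b *: q].
Proof.
move=> r0 FG; pose toC := real_complex R.
(* Write the common complex eigenvector as [v = p + i q]. For eigenvalues [a + i a'] and [b + i b'],
   real and imaginary parts give the four real relations. *)
have [|v v0 /andP[]] :=
    @common_eigenvector2 R[i] r (map_mx toC F) (map_mx toC G) r0.
  by rewrite -!map_mxM FG.
move=> /sub_rVP[a va] /sub_rVP[b vb].
have split (H : 'M[R]_r) c : v *m map_mx toC H = c *: v ->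
    map_mx (@complex.Re R) v *m H
      = complex.Re c *: map_mx (@complex.Re R) v
        - complex.Im c *: map_mx (@complex.Im R) v /\
    map_mx (@complex.Im R) v *m H
      = complex.Im c *: map_mx (@complex.Re R) v
        + complex.Re c *: map_mx (@complex.Im R) v.
  have reM (x : R[i]) y : complex.Re (x * toC y) = complex.Re x * y.
    by case: x => ? ? /=; rewrite mulr0 subr0.
  have imM (x : R[i]) y : complex.Im (x * toC y) = complex.Im x * y.
    by case: x => ? ? /=; rewrite mulr0 add0r.
  move=> vH; split; apply/rowP=> j; have /rowP/(_ j) := vH; rewrite !mxE.
    (* [Re] is read on [Rcomplex R], the complex numbers as a real vector space, so that it
       distributes over the sum. *)
    move=> /(congr1 (@complex.Re R : Rcomplex R -> R)).
    rewrite (raddf_sum (@complex.Re R : Rcomplex R -> R)) => E.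
    transitivity (complex.Re (c * v 0 j)); last by case: c {vH E} (v 0 j) => ? ? [].
    by rewrite -[RHS]E; apply: eq_bigr => k _; rewrite !mxE [RHS]reM.
  move=> /(congr1 (@complex.Im R : Rcomplex R -> R)).
  rewrite (raddf_sum (@complex.Im R : Rcomplex R -> R)) => E.
  transitivity (complex.Im (c * v 0 j)).
    by rewrite -[RHS]E; apply: eq_bigr => k _; rewrite !mxE [RHS]imM.
  by case: c {vH E} (v 0 j) => ? ? [] ? ? /=; rewrite addrC.
have [pF qF] := split _ _ va; have [pG qG] := split _ _ vb.
do 2!eexists; exists (complex.Re a), (complex.Im a), (complex.Re b), (complex.Im b).
split; [|exact: pF|exact: qF|exact: pG|exact: qG].
apply: contraNT v0; rewrite negb_or !negbK => /andP[/eqP p0 /eqP q0].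
apply/eqP/rowP=> j; move/rowP/(_ j): p0; move/rowP/(_ j): q0; rewrite !mxE.
by case: (v 0 j) => ? ? /= -> ->.
Qed.

(** In a basis [w] of [W], the restrictions of [F] and [G] are matrices [f] and [g], which commute
    because [w] is row-free. An eigenpair of these is carried back by [w]. *)
Lemma stable_real_eigenpair {R : rcfType} {m r : nat} {F G : 'M[R]_m}
    {W : 'M[R]_(r, m)} :
  W != 0 -> F *m G = G *m F -> stablemx W F -> stablemx W G ->
  exists (p q : 'rV[R]_m) (a a' b b' : R),
    [/\ (p != 0) || (q != 0), (p <= W)%MS /\ (q <= W)%MS,
        p *m F = a *: p - a' *: q /\ q *m F = a' *: p + a *: q &
        p *m G = b *: p - b' *: q /\ q *m G = b' *: p + b *: q].
Proof.
move=> W0 FG sF sG; have [w wfree eqw] : exists2 w : 'M_(\rank W, m), row_free w & (w :=: W)%MS.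
  by exists (row_base W); [exact: row_base_free | exact: eq_row_base].
have restr H : stablemx W H -> exists h, w *m H = h *m w.
  move=> sH; apply/submxP; rewrite eqw.
  by apply: submx_trans sH; rewrite submxMr ?eqw.
have [f wf] := restr _ sF; have [g wg] := restr _ sG.
have fg : f *m g = g *m f.
  apply: (row_free_inj wfree).
  by rewrite -!mulmxA -wf -wg !mulmxA -wf -wg -!mulmxA FG.
have [|p [q [a [a' [b [b' [pq0 pf qf pg qg]]]]]]] :=
    commuting_real_eigenpair _ fg.
  by rewrite lt0n mxrank_eq0.
exists (p *m w), (q *m w), a, a', b, b'; split.
- by rewrite -!(mul0mx _ w) !(inj_eq (row_free_inj wfree)).
- by split; apply: submx_trans (submxMl _ _) _; rewrite eqw.
- by rewrite -!mulmxA wf !mulmxA pf qf mulmxBl mulmxDl -!scalemxAl.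
- by rewrite -!mulmxA wg !mulmxA pg qg mulmxBl mulmxDl -!scalemxAl.
Qed.

(** * Bilinear forms on row vectors *)

Definition bform {R : comPzRingType} {m : nat} (S : 'M[R]_m) (x y : 'rV[R]_m) : R :=
  (x *m S *m y^T) 0 0.

Section BilinearForm.
Context {R : comPzRingType} {m : nat} (S : 'M[R]_m).
Implicit Types (x y : 'rV[R]_m) (c : R).

Lemma bformDl x x' y : bform S (x + x') y = bform S x y + bform S x' y.
Proof. by rewrite /bform !mulmxDl mxE. Qed.

Lemma bformZl c x y : bform S (c *: x) y = c * bform S x y.
Proof. by rewrite /bform -!scalemxAl mxE. Qed.

Lemma bformNl x y : bform S (- x) y = - bform S x y.
Proof. by rewrite -scaleN1r bformZl mulN1r. Qed.

Lemma bformZr c x y : bform S x (c *: y) = c * bform S x y.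
Proof. by rewrite /bform linearZ /= -scalemxAr mxE. Qed.

Lemma bform_tr x y : bform S x y = bform S^T y x.
Proof.
rewrite /bform; have -> : y *m S^T *m x^T = (x *m S *m y^T)^T.
  by rewrite !trmx_mul trmxK mulmxA.
by rewrite [RHS]mxE.
Qed.

Lemma bform_skew x y : S^T = - S -> bform S y x = - bform S x y.
Proof. by move=> St; rewrite bform_tr St /bform mulmxN mulNmx mxE. Qed.

Lemma bform_sym x y : S^T = S -> bform S y x = bform S x y.
Proof. by move=> St; rewrite bform_tr St. Qed.

Lemma bform_row r s (X : 'M[R]_(r, m)) (Y : 'M[R]_(s, m)) i j :
  (X *m S *m Y^T) i j = bform S (row i X) (row j Y).
Proof. by rewrite /bform -row_mul !mxE; apply: eq_bigr => k _; rewrite !mxE. Qed.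

End BilinearForm.

Lemma bform_gt0 {R : numDomainType} {m : nat} {S : 'M[R]_m} {x : 'rV[R]_m} :
  sym_posdef S -> x != 0 -> 0 < bform S x x.
Proof.
by case=> _ S0 x0; have := S0 x^T; rewrite trmxK; apply; rewrite -trmx0 (inj_eq trmx_inj).
Qed.

(** * Planes rotated by [S *m J] and symplectic families *)

Section SymplecticForm.
Context {R : rcfType} {m : nat} {J : 'M[R]_m}.
Hypotheses (Jskew : J^T = - J) (Jsq : J *m J = - 1%:M).

Local Notation omega := (bform J).

Lemma omega_skew x y : omega y x = - omega x y.
Proof. exact: bform_skew. Qed.

Lemma omega_diag x : omega x x = 0.
Proof. by have := omega_skew x x; lra. Qed.

Lemma mulmx_JK k (X : 'M[R]_(k, m)) (S : 'M[R]_m) :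
  X *m S = - (X *m (S *m J) *m J).
Proof. by rewrite -!mulmxA Jsq mulmxN mulmx1 mulmxN opprK. Qed.

(** As [J] has inverse [- J], the form of [S] is recovered from [omega] and the action of [S *m J];
    symmetry and positivity of [S] thus constrain eigenpairs of [S *m J]. *)
Lemma bform_omega S x y : bform S x y = - omega (x *m (S *m J)) y.
Proof. by rewrite /bform mulmx_JK mulNmx mxE. Qed.

(** Both diagonal values of the form of [S] on [p], [q] equal [- (a' * omega p q)], so positivity
    excludes [omega p q = 0]. The two mixed values are opposite multiples of [a * omega p q], so
    symmetry forces [a = 0]. *)
Lemma eigenpair_imaginary {S : 'M[R]_m} {p q : 'rV[R]_m} {a a'} :
  sym_posdef S -> (p != 0) || (q != 0) ->
  p *m (S *m J) = a *: p - a' *: q -> q *m (S *m J) = a' *: p + a *: q ->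
  omega p q != 0 /\ a = 0.
Proof.
move=> S0 pq0 pS qS.
have Spp : bform S p p = - (a' * omega p q).
  by rewrite bform_omega pS bformDl bformNl !bformZl omega_diag (omega_skew p q); ring.
have Sqq : bform S q q = - (a' * omega p q).
  by rewrite bform_omega qS bformDl !bformZl omega_diag; ring.
have Spq : bform S p q = - (a * omega p q).
  by rewrite bform_omega pS bformDl bformNl !bformZl omega_diag; ring.
have Sqp : bform S q p = a * omega p q.
  by rewrite bform_omega qS bformDl !bformZl omega_diag (omega_skew p q); ring.
have w0 : omega p q != 0.
  apply: contraTneq pq0 => w0; rewrite negb_or.
  move: Spp Sqq; rewrite w0 mulr0 oppr0 => Spp Sqq.
  by rewrite -[p != 0]negbK -[q != 0]negbK; apply/andP; split; apply/negP;
    rewrite negbK => /(bform_gt0 S0); rewrite ?Spp ?Sqq ltxx.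
split=> //; apply: (mulIf w0); rewrite mul0r.
by have := bform_sym S p q S0.1; rewrite Spq Sqp; lra.
Qed.

(** Equivalently, [x + i y] satisfies the eigenvector equation of [S *m J] for [- i c]. With this
    sign, [omega x y = 1] gives [c = bform S x x]. *)
Definition rotates (S : 'M[R]_m) (x y : 'rV[R]_m) (c : R) :=
  x *m (S *m J) = c *: y /\ y *m (S *m J) = - c *: x.

Lemma rotates_scale S x y c s : rotates S x y c -> rotates S (s *: x) (s *: y) c.
Proof.
by move=> [xS yS]; split; rewrite -scalemxAl (xS, yS) !scalerA mulrC.
Qed.

Lemma rotates_swap S x y c : rotates S x y c -> rotates S y x (- c).
Proof. by move=> [xS yS]; split; rewrite ?opprK. Qed.

(** Both vectors get the same factor, which leaves the rotation constants unchanged. *)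
Lemma omega_normalize {p q : 'rV[R]_m} : 0 < omega p q ->
  exists s, omega (s *: p) (s *: q) = 1.
Proof.
move=> w0; exists (Num.sqrt (omega p q))^-1.
rewrite bformZl bformZr mulrA -invfM -expr2 sqr_sqrtr ?ltW// mulVf //.
exact: lt0r_neq0.
Qed.

Lemma rotated_symplectic_pair {r} {A B : 'M[R]_m} {W : 'M[R]_(r, m)} :
  sym_posdef A -> sym_posdef B -> A *m J *m B = B *m J *m A -> W != 0 ->
  stablemx W (A *m J) -> stablemx W (B *m J) ->
  exists (x y : 'rV[R]_m) (a b : R),
    [/\ (x <= W)%MS /\ (y <= W)%MS, omega x y = 1, rotates A x y a & rotates B x y b].
Proof.
move=> A0 B0 AB W0 sA sB.
have [|p [q [a [a' [b [b' [pq0 [pW qW] [pA qA] [pB qB]]]]]]]] :=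
    stable_real_eigenpair W0 _ sA sB; first by rewrite !mulmxA AB.
have [w0 a0] := eigenpair_imaginary A0 pq0 pA qA.
have [_ b0] := eigenpair_imaginary B0 pq0 pB qB.
have rA : rotates A p q (- a').
  by split; rewrite (pA, qA) a0 scale0r ?opprK ?add0r ?addr0 // scaleNr.
have rB : rotates B p q (- b').
  by split; rewrite (pB, qB) b0 scale0r ?opprK ?add0r ?addr0 // scaleNr.
(* If [omega p q] is negative, exchanging [p] and [q] makes it positive and negates both
   constants. *)
move: w0; rewrite neq_lt => /orP[w0|w0].
  have [|s s1] := @omega_normalize q p; first by rewrite omega_skew; lra.
  exists (s *: q), (s *: p), (- - a'), (- - b'); split; rewrite ?scalemx_sub //;
    exact/rotates_scale/rotates_swap.
have [s s1] := omega_normalize w0.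
by exists (s *: p), (s *: q), (- a'), (- b'); split; rewrite ?scalemx_sub //;
  exact/rotates_scale.
Qed.

Definition symplectic_family {k} (x y : 'I_k -> 'rV[R]_m) :=
  forall i j, [/\ omega (x i) (x j) = 0, omega (y i) (y j) = 0 &
                  omega (x i) (y j) = (i == j)%:R].

(** Induction on [k]: a new pair is taken in the symplectic complement of the earlier ones, which
    the bound on [k] keeps nonzero. *)
Lemma rotated_symplectic_family {A B : 'M[R]_m} k :
  sym_posdef A -> sym_posdef B -> A *m J *m B = B *m J *m A -> (k.*2 <= m)%N ->
  exists (x y : 'I_k -> 'rV[R]_m) (a b : 'I_k -> R),
    symplectic_family x y /\
    forall i, rotates A (x i) (y i) (a i) /\ rotates B (x i) (y i) (b i).
Proof.
move=> A0 B0 AB; elim: k => [_|k IH km].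
  by do 2!exists (fun=> 0); do 2!exists (fun=> 0); split=> - [].
have [|x [y [a [b [xy rot]]]]] := IH; first by lia.
(* Multiplying [v] by [pairing z] lists the values [omega v (z i)], so the kernel [W] is the
   symplectic complement of all [x i] and [y i]. *)
pose pairing (z : 'I_k -> 'rV[R]_m) := \matrix_(l < m, i < k) (J *m (z i)^T) l 0.
pose W := kermx (row_mx (pairing x) (pairing y)).
have mul_pairing (v : 'rV[R]_m) z : v *m pairing z = \row_i omega v (z i).
  by apply/rowP=> i; rewrite [RHS]mxE /bform -mulmxA !mxE; apply: eq_bigr => l _; rewrite !mxE.
have inW (v : 'rV[R]_m) :
    (v <= W)%MS <-> forall i, omega v (x i) = 0 /\ omega v (y i) = 0.
  split=> [/sub_kermxP|vW].
    rewrite mul_mx_row !mul_pairing => /eqP; rewrite row_mx_eq0.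
    move=> /andP[/eqP/rowP vx /eqP/rowP vy] i.
    by move: (vx i) (vy i); rewrite !mxE.
  apply/sub_kermxP/eqP; rewrite mul_mx_row !mul_pairing row_mx_eq0.
  by apply/andP; split; apply/eqP/rowP => i; rewrite !mxE; have [] := vW i.
have W0 : W != 0.
  (* The kernel has rank at least [m - 2k], and [2k + 2 <= m]. *)
  rewrite -mxrank_eq0 mxrank_ker.
  by have := rank_leq_col (row_mx (pairing x) (pairing y)); lia.
have stable S c : sym_posdef S -> (forall i, rotates S (x i) (y i) (c i)) ->
    stablemx W (S *m J).
  move=> S0 rS; apply/row_subP => t; rewrite row_mul; apply/inW => i.
  have [vx vy] := (inW _).1 (row_sub t W) i.
  (* Symmetry of [S] makes [S *m J] skew-adjoint for [omega]; since it preserves the planes of the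
     [x i], [y i], it preserves their complement. *)
  have adj z z' : omega (z *m (S *m J)) z' = omega (z' *m (S *m J)) z.
    by apply: oppr_inj; rewrite -!bform_omega; apply: bform_sym S0.1.
  by rewrite !(adj (row t W)) (rS i).1 (rS i).2 !bformZl !(omega_skew (row t W)) vx vy; split; ring.
have [p [q [c [d [[/inW pW /inW qW] pq1 pqA pqB]]]]] :=
  rotated_symplectic_pair A0 B0 AB W0 (stable A a A0 (fun i => (rot i).1))
    (stable B b B0 (fun i => (rot i).2)).
(* The new pair takes index 0 and the earlier ones are shifted up. *)
pose ext T (z0 : T) (z : 'I_k -> T) i := oapp z z0 (unlift ord0 i).
exists (ext _ p x), (ext _ q y), (ext _ c a), (ext _ d b).
have ext0 T z0 z : ext T z0 z ord0 = z0 by rewrite /ext unlift_none.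
have extS T z0 z i : ext T z0 z (lift ord0 i) = z i by rewrite /ext liftK.
split=> [i j|i].
  case: (unliftP ord0 i) => [i'|] ->; case: (unliftP ord0 j) => [j'|] ->;
    rewrite ?ext0 ?extS ?(inj_eq (lift_inj (h := ord0))).
  - exact: xy.
  - by split; rewrite omega_skew ?(pW i').1 ?(qW i').1 ?(qW i').2 ?oppr0.
  - by have [px py] := pW j'; have [qx qy] := qW j'; split.
  - by rewrite !omega_diag pq1 eqxx.
by case: (unliftP ord0 i) => [i'|] ->; rewrite ?ext0 ?extS.
Qed.

Lemma bform_rotates {S : 'M[R]_m} {x y c} z :
  rotates S x y c ->
  bform S x z = - (c * omega y z) /\ bform S y z = c * omega x z.
Proof.
by move=> [xS yS]; rewrite !(bform_omega S) xS yS !bformZl mulNr opprK.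
Qed.

End SymplecticForm.

(** * The matrix [Jmx] and symplectic matrices *)

Lemma Jmx_skew (R : comPzRingType) n : (Jmx R n)^T = - Jmx R n.
Proof.
apply/matrixP=> i j; rewrite [LHS]mxE [RHS]mxE.
case: (mxtens_indexP i) => {}i s; case: (mxtens_indexP j) => {}j t.
rewrite !tensmxE !mxE -mulrN eq_sym.
by congr (_ * _); case: s => [[|[|[]]] //= _]; case: t => [[|[|[]]] //= _]; rewrite ?oppr0 ?opprK.
Qed.

Lemma J2_sq (R : comPzRingType) : J2 R *m J2 R = - 1%:M.
Proof.
apply/matrixP=> [[[|[|[]]] //= ?] [[|[|[]]] //= ?]];
  rewrite !mxE !big_ord_recl big_ord0 !mxE /=;
  by rewrite ?(mulr0, mul0r, mulr1, mul1r, addr0, add0r, oppr0, mulr1n, mulr0n).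
Qed.

Lemma Jmx_sq (R : comPzRingType) n : Jmx R n *m Jmx R n = - 1%:M.
Proof.
rewrite /Jmx tensmx_mul mul1mx J2_sq; apply/matrixP=> i j; rewrite [RHS]mxE.
case: (mxtens_indexP i) => {}i s; case: (mxtens_indexP j) => {}j t.
by rewrite tensmxE !mxE (can_eq (@mxtens_indexK _ _)) xpair_eqE mulrN -natrM mulnb.
Qed.

Lemma symplectic_mulVmx {R : comPzRingType} {n} {M : 'M[R]_(n * 2)} :
  symplectic M -> - (Jmx R n *m M^T *m Jmx R n) *m M = 1%:M.
Proof.
by rewrite /symplectic => MJ; rewrite mulNmx -!mulmxA (mulmxA M^T) MJ Jmx_sq opprK.
Qed.

(** The left inverse [- (J M^T J)] of [M] is also a right inverse; multiply on the right by [J]. *)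
Lemma symplectic_tr {R : comUnitRingType} {n} {M : 'M[R]_(n * 2)} :
  symplectic M -> M *m Jmx R n *m M^T = Jmx R n.
Proof.
move=> /symplectic_mulVmx /mulmx1C; rewrite mulmxN !mulmxA.
move=> /(congr1 (fun X => X *m Jmx R n)).
by rewrite mulNmx -!mulmxA Jmx_sq !mulmxN mulmx1 mul1mx opprK !mulmxA.
Qed.

Theorem mainTheorem6 (R : realType) (n : nat) (A B : 'M[R]_(n * 2)) :
  sym_posdef A -> sym_posdef B ->
  ((exists (M : 'M[R]_(n * 2)) (dA dB : 'rV[R]_n),
      symplectic M /\
      (forall i, 0 < dA 0 i) /\ (forall i, 0 < dB 0 i) /\
      M^T *m A *m M = tensmx (diag_mx dA) (1%:M : 'M[R]_2) /\
      M^T *m B *m M = tensmx (diag_mx dB) (1%:M : 'M[R]_2))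
   <-> A *m Jmx R n *m B = B *m Jmx R n *m A).
Proof.
move=> A0 B0; split=> [[M [dA [dB [MJ [_ [_ [MA MB]]]]]]]|AB].
  have MJt := symplectic_tr MJ.
  have Mu : M \in unitmx.
    by case/mulmx1_unit: (symplectic_mulVmx MJ).
  have Mtu : M^T \in unitmx by rewrite unitmx_tr.
  apply: (can_inj (mulKmx Mtu)); apply: (can_inj (mulmxK Mu)).
  (* Replacing [J] by [M J M^T] reduces the claim to the two block-diagonal matrices, where it says
     that diagonal matrices commute. *)
  have E (X Y : 'M[R]_(n * 2)) : M^T *m (X *m Jmx R n *m Y) *m M =
      (M^T *m X *m M) *m Jmx R n *m (M^T *m Y *m M).
    by rewrite -{1}MJt !mulmxA.
  by rewrite !E MA MB /Jmx !tensmx_mul !mul1mx !mulmx1 diag_mxC.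
have Jskew := Jmx_skew R n; have Jsq := Jmx_sq R n.
have [|x [y [a [b [xy rot]]]]] :=
  rotated_symplectic_family Jskew Jsq n A0 B0 AB; first by lia.
(* The basis is ordered as in the Kronecker index: [x i] then [y i] in block [i]. These are the rows
   of [N], and [M] will be [N^T]. *)
pose z (k : 'I_(n * 2)) : 'rV[R]_(n * 2) :=
  let: (i, s) := mxtens_unindex k in if s == 0 then x i else y i.
pose N : 'M[R]_(n * 2) := \matrix_k z k.
have NE S k l : (N *m S *m N^T) k l = bform S (z k) (z l).
  by rewrite bform_row !rowK.
have zE i s : z (mxtens_index (i, s)) = if s == 0 then x i else y i.
  by rewrite /z mxtens_indexK.
have pos S c : sym_posdef S -> (forall i, rotates (J := Jmx R n) S (x i) (y i) (c i)) ->
    (forall i, 0 < c i) /\ N *m S *m N^T = tensmx (diag_mx (\row_i c i)) 1%:M.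
  move=> S0 rS; have rb i := bform_rotates Jsq _ (rS i).
  split=> [i|].
    (* Here [c i] is the value of the form of [S] at [x i], which is nonzero because
       [omega (x i) (y i) = 1]. *)
    have [_ _ xy1] := xy i i; rewrite eqxx mulr1n in xy1.
    have x0 : x i != 0.
      by apply: contra_eq_neq xy1 => ->; rewrite /bform !mul0mx mxE eq_sym oner_eq0.
    by have := bform_gt0 S0 x0; rewrite (rb _ i).1 (omega_skew Jskew (x i)) xy1; lra.
  (* The rotation relations express each Gram entry of [S] as plus or minus [c i] times a value of
     [omega] on the family. *)
  apply/matrixP=> k l; rewrite NE.
  case: (mxtens_indexP k) => i s; case: (mxtens_indexP l) => j t.
  rewrite !zE tensmxE !mxE -[c i *+ _]mulr_natr.
  have [xx yy xyij] := xy i j; have [_ _ xyji] := xy j i.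
  case: s => [[|[|[]]] //= ?]; case: t => [[|[|[]]] //= ?]; rewrite ?(rb _ i).1 ?(rb _ i).2;
    rewrite ?(omega_skew Jskew (x j) (y i)) ?xx ?yy ?xyij ?xyji ?(eq_sym j) /=; ring.
have [[cA NA] [cB NB]] := (pos A a A0 (fun i => (rot i).1), pos B b B0 (fun i => (rot i).2)).
exists N^T, (\row_i a i), (\row_i b i); rewrite trmxK NA NB.
split; last by do ![split] => // i; rewrite mxE.
(* The Gram matrix of [omega] on the ordered family is [Jmx] itself. *)
rewrite /symplectic trmxK; apply/matrixP=> k l; rewrite NE.
case: (mxtens_indexP k) => i s; case: (mxtens_indexP l) => j t.
rewrite !zE tensmxE !mxE.
have [xx yy xyij] := xy i j; have [_ _ xyji] := xy j i.
case: s => [[|[|[]]] //= ?]; case: t => [[|[|[]]] //= ?];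
  rewrite ?(omega_skew Jskew (x j) (y i)) ?xx ?yy ?xyij ?xyji ?(eq_sym j) /=; ring.
Qed.
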